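(* Let $u(x,t)=\sum_{i=1}^3p_i(t)e^{-|x-q_i(t)|}$ be a threepeakon solution to the Camassa--Holm equation with initial data $(q(0),p(0))$ satisfying $q(0)\in\Omega=\{(q_1,q_2,q_3)\in\mathbb{R}^3 : q_1>q_2>q_3\}$ and $p_i(0)\neq 0$, $i=1,2,3$. Then a necessary condition for the threepeakon to collide (in a finite time) is $$p_1(0)<0<p_2(0)\qquad\text{or}\qquad p_2(0)<0<p_3(0).$$ That is, if the threepeakon collides, then at least one of these two conditions holds.
   Context: The Camassa--Holm equation is $u_t-u_{xxt}+3uu_x-2u_xu_{xx}-uu_{xxx}=0$. A threepeakon solution is a function $u(x,t)=\sum_{i=1}^3 p_i(t)e^{-|x-q_i(t)|}$ where $q=(q_1,q_2,q_3)$, $p=(p_1,p_2,p_3)$ solve the Hamiltonian system $\dot q_i=\partial H/\partial p_i$, $\dot p_i=-\partial H/\partial q_i$, $i=1,2,3$, with $H(q,p)=\frac12\sum_{i,j=1}^3 p_ip_je^{-|q_i-q_j|}$. With $q(0)\in\Omega$, the solution is the maximal forward solution of this system with $q(t)\in\Omega$. The threepeakon collides at a (finite) time $t^*>0$ if the solution exists with $q(t)\in\Omega$ on $[0,t^* )$, $q$ extends continuously to $t^*$, and $q_i(t^* )=q_j(t^* )$ for some $i\neq j$. *)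

(* Defs.v *)
From HB Require Import structures.
From mathcomp Require Import all_boot all_order all_algebra.
From mathcomp Require Import all_classical all_reals all_analysis.
Set Implicit Arguments.
Unset Strict Implicit.
Unset Printing Implicit Defensive.
Import Order.TTheory GRing.Theory Num.Theory.
Import numFieldNormedType.Exports.
Local Open Scope classical_set_scope.
Local Open Scope ring_scope.

(* Triples (v_1, v_2, v_3) are row vectors indexed from 0, so v_k is the entry
   v 0 (k - 1); the numerals 0, 1, 2 are used as elements of 'I_3. *)

Definition Omega {R : realType} : set 'rV[R]_3 :=
  [set q : 'rV[R]_3 | q 0 1 < q 0 0 /\ q 0 2 < q 0 1].

Definition hamiltonian {R : realType} (q p : 'rV[R]_3) : R :=
  2^-1 * \sum_(i < 3) \sum_(j < 3)
    p 0 i * p 0 j * expR (- `|q 0 i - q 0 j|).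

(* Partial derivative as the directional derivative along the i-th basis
   vector.  [hamiltonian] is smooth in p, and in q on [Omega], so the limits
   used in [hamiltonian_flow] exist. *)
Definition partial {R : realType} (f : 'rV[R]_3 -> R) (i : 'I_3)
    (v : 'rV[R]_3) : R :=
  'D_(delta_mx 0 i) f v.

(* Forward solution in Omega on [0, T), T being finite or +oo.  At the initial
   time only right-continuity is asked; together with the equations on (0, T)
   this is equivalent to the equations holding at 0 with one-sided
   derivatives.  Values of q and p outside [0, T) are irrelevant. *)
Definition hamiltonian_flow {R : realType} (T : \bar R)
    (q p : R -> 'rV[R]_3) : Prop :=
  [/\ (0 < T)%E,
      forall t : R, 0 <= t -> (t%:E < T)%E -> Omega (q t),
      q t @[t --> 0^'+] --> q 0 /\ p t @[t --> 0^'+] --> p 0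
    & forall (t : R) (i : 'I_3), 0 < t -> (t%:E < T)%E ->
        is_derive t 1 (fun s => q s 0 i)
          (partial (fun y => hamiltonian (q t) y) i (p t)) /\
        is_derive t 1 (fun s => p s 0 i)
          (- partial (fun y => hamiltonian y (p t)) i (q t))].

Definition maximal_hamiltonian_flow {R : realType} (T : \bar R)
    (q p : R -> 'rV[R]_3) : Prop :=
  hamiltonian_flow T q p /\
  forall (T' : \bar R) (q' p' : R -> 'rV[R]_3),
    hamiltonian_flow T' q' p' ->
    (forall t : R, 0 <= t -> (t%:E < T)%E -> q' t = q t /\ p' t = p t) ->
    (T' <= T)%E.

Definition threepeakon_solution {R : realType} (T : \bar R)
    (q p : R -> 'rV[R]_3) (u : R -> R -> R) : Prop :=
  maximal_hamiltonian_flow T q p /\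
  forall x t : R, 0 <= t -> (t%:E < T)%E ->
    u x t = \sum_(i < 3) p t 0 i * expR (- `|x - q t 0 i|).

(* For a solution on [0, T): tstar <= T says that it exists on [0, tstar), and
   qstar is the value at tstar of the continuous extension of q. *)
Definition collides_at {R : realType} (T : \bar R) (q : R -> 'rV[R]_3)
    (tstar : R) : Prop :=
  [/\ 0 < tstar, (tstar%:E <= T)%E
    & exists2 qstar : 'rV[R]_3, q t @[t --> tstar^'-] --> qstar
      & exists i j : 'I_3, i != j /\ qstar 0 i = qstar 0 j].

(* Main.v *)
Require Import Defs.
From mathcomp Require Import all_boot all_order all_algebra.
From mathcomp Require Import all_classical all_reals all_analysis.
From mathcomp Require Import ring lra.
Import Order.TTheory GRing.Theory Num.Theory.
Import numFieldNormedType.Exports.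
Local Open Scope classical_set_scope.
Local Open Scope ring_scope.

(** Write [E_ij] for [exp (- |q_i - q_j|)] and [S_ij] for the sign of
    [q_i - q_j].  While the positions are distinct, Hamilton's equations read
[[
      q_i' = sum_j p_j E_ij,        p_i' = p_i * sum_j p_j S_ij E_ij.
]]
    The second equation is linear in [p_i], so no [p_i] can reach zero, and the
    signs [sigma_i] of the momenta are constant in time
    ([flow_p_neq0], [flow_sg_p]).  Hence the total mass [sum_i |p_i|] equals
    [sum_i sigma_i p_i], whose derivative is
[[
      sum_(i < j) (sigma_i - sigma_j) S_ij p_i p_j E_ij,   with S_ij = 1
]]
    because [q_i > q_j] for [i < j].  If both alternatives of the conclusion
    fail, the signs are ordered as [sigma_1 >= sigma_2 >= sigma_3]; then a
    term with [sigma_i <> sigma_j] has [sigma_i = 1] and [sigma_j = -1], so it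
    is negative.  The total mass therefore never exceeds its initial value [K]
    ([flow_mass_le]).

    A bound [K] on the mass rules out collisions: [x |-> exp (- |x|)] is
    1-Lipschitz, so a gap [d = q_i - q_j > 0] satisfies [|d'| <= K d], and
    Gronwall's inequality gives [d t >= d 0 * exp (- K t)] ([flow_gap_ge]).
    A gap bounded below by a positive constant on bounded time intervals
    cannot tend to zero in finite time.

    All three uses of the differential equations (momenta do not vanish, the
    mass does not grow, gaps do not close) are instances of the same inequality
    [gronwall_lower_bound]. *)

(** * Derivatives of the Hamiltonian *)

Lemma scale_realE (R : realType) (a b : R) : a *: b = a * b.
Proof. by []. Qed.

(** Turns a partial derivative into the derivative of a function of one real
    variable, to which the rules of calculus on the real line apply. *)
Lemma derive_along_line (R : realType) (V : normedModType R) (f : V -> R)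
    (v x : V) : 'D_v f x = 'D_1 (fun h : R => f (h *: v + x)) 0.
Proof.
rewrite /derive; under [in RHS]eq_fun do rewrite /= [_ *: 1]mulr1 !addr0.
by rewrite scale0r add0r.
Qed.

(** The case [x = 0], [c = 0] is the one of the diagonal terms
    [|q_i - q_i|] of the Hamiltonian, which are constant although the absolute
    value is not differentiable at zero. *)
Lemma is_derive_abs_affine (R : realType) (x c : R) : (x = 0 -> c = 0) ->
  is_derive (0 : R) 1 (fun h => `|x + h * c|) (Num.sg x * c).
Proof.
have [-> /(_ erefl) ->|x0 _] := eqVneq x 0.
  rewrite mulr0; apply: (@near_eq_is_derive _ _ _ (cst 0)).
  by near=> h; rewrite mulr0 addr0 normr0.
apply: (@near_eq_is_derive R R R (fun h : R => Num.sg x * (x + h * c))).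
  have h0 : x + h * c @[h --> (0 : R)] --> x.
    rewrite -[X in _ --> X]addr0 -[X in _ --> _ + X](mul0r c).
    apply: cvgD; first exact: cvg_cst.
    by apply: cvgM; [exact: cvg_id|exact: cvg_cst].
  have [xlt|xgt] : x < 0 \/ 0 < x by apply/orP; rewrite -neq_lt.
    near=> h; rewrite ltr0_sg// mulN1r ltr0_norm//; near: h.
    exact: (cvgr_lt _ h0).
  near=> h; rewrite gtr0_sg// mul1r gtr0_norm//; near: h.
  exact: (cvgr_gt _ h0).
have dlin : is_derive (0 : R) 1 (fun h : R => x + h * c) c.
  have := is_deriveD (is_derive_cst x (0 : R) 1)
    (is_deriveM (is_derive_id (0:R) 1) (is_derive_cst c (0 : R) 1)).
  by move/is_derive_eq; apply; rewrite scaler0 !add0r [c *: 1]mulr1.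
exact: (is_deriveZ (Num.sg x) dlin).
Unshelve. all: by end_near.
Qed.

(** Collects the terms of a quadratic form after differentiation in the
    [i]-th variable: each product of two coordinates contributes through
    either factor, which cancels the factor 1/2 of the Hamiltonian. *)
Lemma sum_sym_pick (R : pzRingType) (n : nat) (F : 'I_n -> 'I_n -> R)
    (i : 'I_n) :
  \sum_(k < n) \sum_(l < n) (F k l * (k == i)%:R + F l k * (l == i)%:R)
  = 2 * \sum_(j < n) F i j.
Proof.
under eq_bigr do rewrite big_split.
rewrite big_split /= [X in _ + X]exchange_big /= mulr_natl mulr2n.
suff -> : \sum_(k < n) \sum_(l < n) F k l * (k == i)%:R
  = \sum_(j < n) F i j by [].
rewrite (bigD1 i)//= [X in _ + X]big1 ?addr0 => [|k /negbTE ->].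
  by apply: eq_bigr => l _; rewrite eqxx mulr1.
by apply: big1 => l _; rewrite mulr0.
Qed.

Lemma partial_hamiltonian_p (R : realType) (q p : 'rV[R]_3) (i : 'I_3) :
  partial (hamiltonian q) i p
  = \sum_(j < 3) p 0 j * expR (- `|q 0 i - q 0 j|).
Proof.
rewrite /partial derive_along_line /hamiltonian.
pose c (j : 'I_3) : R := (j == i)%:R.
pose E (k l : 'I_3) := expR (- `|q 0 k - q 0 l|).
have dc k : is_derive (0 : R) 1
    (fun h : R => (h *: delta_mx 0 i + p : 'rV[R]_3) 0 k) (c k).
  have := is_deriveD (is_deriveM (is_derive_id (0 : R) 1)
    (is_derive_cst (c k) (0 : R) 1)) (is_derive_cst (p 0 k) (0 : R) 1).
  rewrite scaler0 add0r addr0 [c k *: 1]mulr1.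
  by congr is_derive; apply/funext => h /=; rewrite !mxE eqxx /=.
have dterm k l : is_derive (0 : R) 1
    (fun h : R => (h *: delta_mx 0 i + p : 'rV[R]_3) 0 k *
                  (h *: delta_mx 0 i + p : 'rV[R]_3) 0 l * E k l)
    ((p 0 k * c l + p 0 l * c k) * E k l).
  have := is_deriveM (is_deriveM (dc k) (dc l))
    (is_derive_cst (E k l) (0 : R) 1).
  move/is_derive_eq; apply.
  by rewrite scaler0 add0r /= !scale0r !add0r [_ *: _]mulrC.
pose H h : R := \sum_(k < 3) \sum_(l < 3)
  ((h *: delta_mx 0 i + p : 'rV[R]_3) 0 k *
   (h *: delta_mx 0 i + p : 'rV[R]_3) 0 l * E k l).
have dH : is_derive (0 : R) 1 H
   (\sum_(k < 3) \sum_(l < 3) ((p 0 k * c l + p 0 l * c k) * E k l)).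
  have := is_derive_sum (fun k => is_derive_sum (dterm k)).
  congr is_derive; apply/funext => h; rewrite /H fct_sumE.
  by apply: eq_bigr => k _; rewrite fct_sumE.
have := is_deriveZ (2^-1 : R) dH => /(@derive_val _ _ _ _ _ _ _) ->.
rewrite scale_realE.
rewrite -[RHS](@mulKf _ 2) ?pnatr_eq0//.
rewrite -(sum_sym_pick _ _ (fun k l => p 0 l * E k l) i).
congr (_ * _); apply: eq_bigr => k _; apply: eq_bigr => l _.
rewrite /c /E /= (distrC (q 0 l)); ring.
Qed.

Lemma partial_hamiltonian_q (R : realType) (q p : 'rV[R]_3) (i : 'I_3) :
  injective (q 0) ->
  partial (hamiltonian^~ p) i q
  = - (p 0 i * \sum_(j < 3)
         p 0 j * Num.sg (q 0 i - q 0 j) * expR (- `|q 0 i - q 0 j|)).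
Proof.
move=> q_inj; rewrite /partial derive_along_line /hamiltonian.
pose c (j : 'I_3) : R := (j == i)%:R.
pose E (k l : 'I_3) := expR (- `|q 0 k - q 0 l|).
pose S (k l : 'I_3) := Num.sg (q 0 k - q 0 l).
pose L k l h := (h *: delta_mx 0 i + q : 'rV[R]_3) 0 k -
                (h *: delta_mx 0 i + q : 'rV[R]_3) 0 l.
have dterm k l : is_derive (0 : R) 1
    (fun h : R => p 0 k * p 0 l * expR (- `|L k l h|))
    (p 0 k * p 0 l * (S k l * E k l) * (c l - c k)).
  have dL : is_derive (0 : R) 1 (fun h : R => `|L k l h|) (S k l * (c k - c l)).
    have : q 0 k - q 0 l = 0 -> c k - c l = 0.
      by move/subr0_eq/q_inj => ->; rewrite subrr.
    move/is_derive_abs_affine; congr is_derive; apply/funext => h.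
    by rewrite /L !mxE eqxx /= /c; congr (`|_|); ring.
  have := is_deriveZ (p 0 k * p 0 l)
    (is_derive1_comp (is_derive_expR _) (is_deriveN dL)).
  move/is_derive_eq; apply.
  have L0 : L k l 0 = q 0 k - q 0 l by rewrite /L scale0r add0r.
  rewrite [(- _ : R -> R) 0]/(- `|L k l 0|) L0 -/(E k l) scale_realE.
  ring.
pose H h : R := \sum_(k < 3) \sum_(l < 3) p 0 k * p 0 l * expR (- `|L k l h|).
have dH : is_derive (0 : R) 1 H (\sum_(k < 3) \sum_(l < 3)
    (p 0 k * p 0 l * (S k l * E k l) * (c l - c k))).
  have := is_derive_sum (fun k => is_derive_sum (dterm k)).
  congr is_derive; apply/funext => h; rewrite /H fct_sumE.
  by apply: eq_bigr => k _; rewrite fct_sumE.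
have := is_deriveZ (2^-1 : R) dH => /(@derive_val _ _ _ _ _ _ _) ->.
rewrite scale_realE.
rewrite [in RHS]mulr_sumr -sumrN.
rewrite -[RHS](@mulKf _ 2) ?pnatr_eq0//.
rewrite -(sum_sym_pick _ _ (fun k l => - (p 0 k * (p 0 l * S k l * E k l))) i).
congr (_ * _); apply: eq_bigr => k _; apply: eq_bigr => l _.
have -> : S l k = - S k l by rewrite /S -sgrN opprB.
rewrite /c /E /= (distrC (q 0 l)); ring.
Qed.

(** * Real inequalities *)

Lemma within_continuous_itv0 (R : realType) (f : R -> R) (t : R) :
  0 < t -> f s @[s --> 0^'+] --> f 0 ->
  (forall s, 0 < s <= t -> derivable f s 1) ->
  {within `[0, t], continuous f}.
Proof.
move=> t0 f0 df.
have cf s : 0 < s <= t -> {for s, continuous f}.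
  by move=> /df/derivable1_diffP/differentiable_continuous.
apply/continuous_within_itvP => //; split => //.
  by move=> s; rewrite in_itv /= => /andP[s0 /ltW st]; apply: cf; rewrite s0.
by apply: cvg_at_left_filter; apply: cf; rewrite t0 lexx.
Qed.

(** The function [f s * exp (K s)] has a nonnegative derivative. *)
Lemma gronwall_lower_bound (R : realType) (f df : R -> R) (K t : R) :
  0 <= t -> f s @[s --> 0^'+] --> f 0 ->
  (forall s, 0 < s <= t -> is_derive s 1 f (df s)) ->
  (forall s, 0 < s <= t -> - (K * f s) <= df s) ->
  f 0 * expR (- (K * t)) <= f t.
Proof.
rewrite le_eqVlt => /predU1P[<-|t0] f0 fdf dfK.
  by rewrite mulr0 oppr0 expR0 mulr1.
pose g s := f s * expR (K * s).
pose dg s := expR (K * s) * (K * f s + df s).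
have gdg s : 0 < s <= t -> is_derive s 1 g (dg s).
  move=> st; have fs := fdf s st.
  have dK : is_derive s 1 (fun s => K * s) K.
    by have := is_deriveZ K (is_derive_id s 1); rewrite [K *: 1]mulr1.
  have := is_deriveM fs (is_derive1_comp (is_derive_expR (K * s)) dK).
  move/is_derive_eq; apply.
  rewrite /dg /= scale_realE scale_realE; ring.
have g0 : g s @[s --> 0^'+] --> g 0.
  apply: cvgM => //; apply: cvg_at_right_filter.
  apply: (@continuous_comp _ _ _ (fun s => K * s) (@expR R));
    last exact: continuous_expR.
  by apply: cvgM; [exact: cvg_cst|exact: cvg_id].
have gc : {within `[0, t], continuous g}.
  by apply: within_continuous_itv0 => // s /gdg[].
have [s /[!in_itv]/= /andP[s0 /ltW st] gE] :
    exists2 s, s \in `]0, t[ & g t - g 0 = dg s * (t - 0).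
  apply: (@MVT R g dg 0 t) => // s; rewrite in_itv /= => /andP[s0 /ltW st].
  by apply: gdg; rewrite s0.
have : 0 <= g t - g 0.
  rewrite gE subr0; apply: mulr_ge0; last exact: ltW.
  apply: mulr_ge0; first exact: expR_ge0.
  by rewrite -lerBlDl sub0r dfK// s0.
by rewrite subr_ge0 /g mulr0 expR0 mulr1 expRN ler_pdivrMr ?expR_gt0.
Qed.

Lemma expRN_lipschitz (R : realType) (x y : R) : 0 <= x -> 0 <= y ->
  `|expR (- x) - expR (- y)| <= `|x - y|.
Proof.
wlog xy : x y / x <= y => [hw x0 y0|x0 _].
  by have [/hw|/ltW/hw] := leP x y; last rewrite distrC (distrC x); exact.
rewrite ger0_norm ?subr_ge0 ?ler_expR ?lerN2// distrC ger0_norm ?subr_ge0//.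
have -> : expR (- x) - expR (- y) = expR (- x) * (1 - expR (- (y - x))).
  by rewrite mulrBr mulr1 -expRD; congr (_ - expR _); ring.
have e1 := expR_ge1Dx (- (y - x)).
have ex : expR (- x) <= 1 by rewrite -expR0 ler_expR oppr_le0.
apply: (@le_trans _ _ (1 * (1 - expR (- (y - x))))); last lra.
by rewrite ler_wpM2r// subr_ge0 -expR0 ler_expR oppr_le0 subr_ge0.
Qed.

Lemma sg_gap_mul_le0 (R : realDomainType) (x y : R) :
  Num.sg y <= Num.sg x -> (Num.sg x - Num.sg y) * (x * y) <= 0.
Proof.
have [->|x0|x0] := sgrP x; first by rewrite mul0r mulr0.
- have [->|y0|y0] := sgrP y => _; first by rewrite !mulr0.
    by rewrite subrr mul0r.
  by apply: mulr_ge0_le0; [lra|rewrite mulr_ge0_le0// ltW].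
- have [->|y0|y0] := sgrP y; [by rewrite !mulr0|lra|].
  by rewrite subrr mul0r.
Qed.

(** With [S] antisymmetric and [E] symmetric, as for the interaction forces,
    exchanging [i] and [j] turns the weight [s i] into [- s j]; averaging both
    expressions shows that only differences of weights matter. *)
Lemma sum_weighted_force (R : numFieldType) (n : nat) (s p : 'I_n -> R)
    (S E : 'I_n -> 'I_n -> R) :
  (forall i j, S i j = - S j i) -> (forall i j, E i j = E j i) ->
  \sum_(i < n) s i * (p i * \sum_(j < n) p j * S i j * E i j)
  = 2^-1 * \sum_(i < n) \sum_(j < n) (s i - s j) * S i j * (p i * p j) * E i j.
Proof.
move=> SN EC; pose A i j := s i * S i j * (p i * p j) * E i j.
have -> : \sum_(i < n) s i * (p i * \sum_(j < n) p j * S i j * E i j)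
    = \sum_(i < n) \sum_(j < n) A i j.
  apply: eq_bigr => i _; rewrite mulrA mulr_sumr.
  by apply: eq_bigr => j _; rewrite /A; ring.
rewrite -[LHS](@mulKf _ 2) ?pnatr_eq0//; congr (_ * _).
rewrite mulr_natl [LHS]mulr2n [X in _ + X]exchange_big -big_split.
apply: eq_bigr => i _.
rewrite -big_split; apply: eq_bigr => j _.
by rewrite /A /= (SN j i) (EC j i); ring.
Qed.

(** * Peakon flows *)

Lemma ord3_cases (i : 'I_3) : [\/ i = 0, i = 1 | i = 2].
Proof.
case: i => -[|[|[|//]]] i3; [apply: Or31|apply: Or32|apply: Or33];
  exact: val_inj.
Qed.

Lemma Omega_lt (R : realType) (q : 'rV[R]_3) (i j : 'I_3) :
  Omega q -> (i < j)%N -> q 0 j < q 0 i.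
Proof.
move=> [q10 q21].
by case: (ord3_cases i) => ->; case: (ord3_cases j) => -> // _;
  exact: lt_trans q10.
Qed.

Lemma Omega_inj (R : realType) (q : 'rV[R]_3) : Omega q -> injective (q 0).
Proof.
move=> qO i j; apply: contra_eq; rewrite neq_ltn.
move=> /orP[]/(Omega_lt _ _ _ _ qO).
  by move/gt_eqF/negbT.
by move/lt_eqF/negbT.
Qed.

Lemma flow_q {R : realType} {T : \bar R} {q p : R -> 'rV[R]_3}
    (flow : hamiltonian_flow T q p) (t : R) (i : 'I_3) :
  0 < t -> (t%:E < T)%E ->
  is_derive t 1 (fun s => q s 0 i)
    (\sum_(j < 3) p t 0 j * expR (- `|q t 0 i - q t 0 j|)).
Proof.
have [_ _ _ flowE] := flow => t0 tT.
by have [+ _] := flowE t i t0 tT; rewrite partial_hamiltonian_p.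
Qed.

Lemma flow_p {R : realType} {T : \bar R} {q p : R -> 'rV[R]_3}
    (flow : hamiltonian_flow T q p) (t : R) (i : 'I_3) :
  0 < t -> (t%:E < T)%E ->
  is_derive t 1 (fun s => p s 0 i)
    (p t 0 i * \sum_(j < 3) p t 0 j * Num.sg (q t 0 i - q t 0 j) *
                            expR (- `|q t 0 i - q t 0 j|)).
Proof.
have [_ qO _ flowE] := flow => t0 tT.
have [_ +] := flowE t i t0 tT; rewrite partial_hamiltonian_q ?opprK//.
by apply: Omega_inj; apply: qO => //; exact: ltW.
Qed.

Lemma flow_cvg0 {R : realType} {T : \bar R} {q p : R -> 'rV[R]_3}
    (flow : hamiltonian_flow T q p) (i : 'I_3) :
  q s 0 i @[s --> 0^'+] --> q 0 0 i /\
  p s 0 i @[s --> 0^'+] --> p 0 0 i.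
Proof.
have [_ _ [q0 p0] _] := flow.
split.
  exact: cvg_comp q0 (@coord_continuous R 1 3 0 i (q 0)).
exact: cvg_comp p0 (@coord_continuous R 1 3 0 i (p 0)).
Qed.

(** The logarithmic derivative of [p_i] is bounded on compact time intervals, so
    Gronwall's inequality applies to [p_i ^ 2].  The bound obtained here depends
    on the interval; a uniform one is the matter of [flow_mass_le]. *)
Lemma flow_p_neq0 {R : realType} {T : \bar R} {q p : R -> 'rV[R]_3}
    (flow : hamiltonian_flow T q p) (t : R) (i : 'I_3) :
  0 <= t -> (t%:E < T)%E -> p 0 0 i != 0 -> p t 0 i != 0.
Proof.
rewrite le_eqVlt => /predU1P[<-//|t0] tT pi0.
have sT s : 0 < s <= t -> 0 < s /\ (s%:E < T)%E.
  by move=> /andP[-> st]; rewrite (le_lt_trans _ tT)// lee_fin.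
have [K Kp] : exists K, forall s, 0 < s <= t -> \sum_(j < 3) `|p s 0 j| <= K.
  have cp j : {within `[0, t], continuous (fun s => p s 0 j)}.
    apply: within_continuous_itv0 => //; first by have [] := flow_cvg0 flow j.
    by move=> s /sT[s0 sltT]; have [] := flow_p flow s j s0 sltT.
  have [j|B BP] := choice (fun j => _ : exists B, forall s,
      0 < s <= t -> `|p s 0 j| <= B).
    have [M _ Mmax] := EVT_max (ltW t0) (cp j).
    have [m _ mmin] := EVT_min (ltW t0) (cp j).
    exists (Num.max (p M 0 j) (- p m 0 j)) => s /andP[s0 st].
    have sI : s \in `[0, t] by rewrite in_itv /= st ltW.
    by rewrite ler_norml lerNl !le_max lerN2 mmin// Mmax// orbT.
  by exists (\sum_(j < 3) B j) => s st; apply: ler_sum => j _; exact: BP.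
pose F s := \sum_(j < 3) p s 0 j * Num.sg (q s 0 i - q s 0 j) *
                            expR (- `|q s 0 i - q s 0 j|).
have FK s : 0 < s <= t -> `|F s| <= K.
  move=> st; apply: le_trans (Kp s st); apply: le_trans (ler_norm_sum _ _ _) _.
  apply: ler_sum => j _; rewrite !normrM -mulrA ler_piMr// mulr_ile1//.
    by rewrite normr_sg; case: eqP.
  by rewrite ger0_norm ?expR_ge0// -expR0 ler_expR oppr_le0.
have [_ p0] := flow_cvg0 flow i.
have := @gronwall_lower_bound R (fun s => p s 0 i ^+ 2)
  (fun s => 2 * p s 0 i ^+ 2 * F s) (2 * K) t (ltW t0).
move/(_ (cvgM p0 p0)) => /= pge.
have : 0 < p t 0 i ^+ 2.
  apply: lt_le_trans (pge _ _).
  - by rewrite mulr_gt0 ?expR_gt0// exprn_even_gt0.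
  - move=> s /sT[s0 sltT].
    have := is_deriveX 2 (flow_p flow s i s0 sltT).
    by move/is_derive_eq; apply; rewrite -/(F s) scale_realE /=; ring.
  - move=> s /FK; rewrite ler_norml => /andP[FK' _].
    have := sqr_ge0 (p s 0 i); nra.
by apply: contraTneq => ->; rewrite expr0n ltxx.
Qed.

Lemma flow_sg_p {R : realType} {T : \bar R} {q p : R -> 'rV[R]_3}
    (flow : hamiltonian_flow T q p) (t : R) (i : 'I_3) :
  0 <= t -> (t%:E < T)%E -> p 0 0 i != 0 ->
  Num.sg (p t 0 i) = Num.sg (p 0 0 i).
Proof.
rewrite le_eqVlt => /predU1P[<-//|t0] tT pi0.
have sT s : 0 <= s <= t -> 0 <= s /\ (s%:E < T)%E.
  by move=> /andP[-> st]; rewrite (le_lt_trans _ tT)// lee_fin.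
have nz s : 0 <= s <= t -> p s 0 i != 0.
  by move=> /sT[s0 sltT]; exact: (flow_p_neq0 flow).
have cp : {within `[0, t], continuous (fun s => p s 0 i)}.
  apply: within_continuous_itv0 => //; first by have [] := flow_cvg0 flow i.
  move=> s /andP[s0 st]; have [|_ sltT] := sT s; first by rewrite ltW.
  by have [] := flow_p flow s i s0 sltT.
have no0 : ~~ (Num.min (p 0 0 i) (p t 0 i) <= 0 <= Num.max (p 0 0 i) (p t 0 i)).
  apply/negP => /(IVT (ltW t0) cp)[s]; rewrite in_itv /= => /nz /negP + /eqP.
  by [].
have := nz t; rewrite lexx ltW// => /(_ isT).
move: no0 pi0; rewrite ge_min le_max.
by case: (sgrP (p 0 0 i)); case: (sgrP (p t 0 i)).
Qed.

(** In the order of the positions from right to left, peakons come before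
    antipeakons.  Two peakons of opposite signs then repel, which decreases
    both of their momenta in absolute value. *)
Lemma flow_mass_le {R : realType} {T : \bar R} {q p : R -> 'rV[R]_3}
    (flow : hamiltonian_flow T q p) (t : R) :
  (forall i, p 0 0 i != 0) ->
  (forall i j : 'I_3, (i < j)%N -> Num.sg (p 0 0 j) <= Num.sg (p 0 0 i)) ->
  0 <= t -> (t%:E < T)%E ->
  \sum_(i < 3) `|p t 0 i| <= \sum_(i < 3) `|p 0 0 i|.
Proof.
move=> p0 sg_mono t0 tT.
pose sigma i := Num.sg (p 0 0 i).
(* Freezing the signs at their initial values makes the mass differentiable. *)
have massE s : 0 <= s -> (s%:E < T)%E ->
    \sum_(i < 3) `|p s 0 i| = \sum_(i < 3) sigma i * p s 0 i.
  move=> s0 sltT; apply: eq_bigr => i _.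
  by rewrite /sigma -(flow_sg_p flow s i)// -normrEsg.
have [T0 qO _ _] := flow.
rewrite !massE// -lerN2.
pose S s i j := Num.sg (q s 0 i - q s 0 j).
pose E s i j := expR (- `|q s 0 i - q s 0 j|).
pose F s := \sum_(i < 3) sigma i *
  (p s 0 i * \sum_(j < 3) p s 0 j * S s i j * E s i j).
(* With rate 0, the inequality says that minus the mass is nondecreasing. *)
have := @gronwall_lower_bound R (fun s => - \sum_(i < 3) sigma i * p s 0 i)
  (fun s => - F s) 0 t t0.
rewrite mul0r oppr0 expR0 mulr1; apply.
- apply: cvgN; apply: cvg_big => [|i _]; first exact: add_continuous.
  by apply: cvgM; [exact: cvg_cst|have [] := flow_cvg0 flow i].
- move=> s /andP[s0 st].
  have sltT : (s%:E < T)%E by rewrite (le_lt_trans _ tT)// lee_fin.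
  have := is_deriveN (is_derive_sum
    (fun i => is_deriveZ (sigma i) (flow_p flow s i s0 sltT))).
  by congr is_derive; apply/funext => h; congr (- _); rewrite fct_sumE.
- move=> s /andP[s0 st].
  have sltT : (s%:E < T)%E by rewrite (le_lt_trans _ tT)// lee_fin.
  have SN i j : S s i j = - S s j i by rewrite /S -sgrN opprB.
  have EC i j : E s i j = E s j i by rewrite /E distrC.
  rewrite mul0r oppr0 oppr_ge0 /F sum_weighted_force//.
  rewrite pmulr_rle0 ?invr_gt0//.
  apply: sumr_le0 => i _; apply: sumr_le0 => j _.
  rewrite pmulr_lle0 ?expR_gt0//.
  (* Both sign differences change sign when i and j are exchanged. *)
  wlog ij : i j / (i < j)%N => [hw|].
    have [/hw//|/hw|/val_inj->] := ltngtP i j; last by rewrite subrr !mul0r.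
    by apply: le_trans; rewrite (SN j i) (mulrC (p s 0 j)) mulrN -mulNr opprB.
  have -> : S s i j = 1.
    rewrite /S gtr0_sg// subr_gt0; apply: Omega_lt => //; apply: qO => //.
    exact: ltW.
  rewrite mulr1; have := sg_mono i j ij.
  rewrite /sigma -(flow_sg_p flow s i _ sltT (p0 i)) ?(ltW s0)//.
  rewrite -(flow_sg_p flow s j _ sltT (p0 j)) ?(ltW s0)//.
  exact: sg_gap_mul_le0.
Qed.

(** A bound on the mass bounds the speed at which two peakons approach, relative
    to their distance. *)
Lemma flow_gap_ge {R : realType} {T : \bar R} {q p : R -> 'rV[R]_3}
    (flow : hamiltonian_flow T q p) (K t : R) (i j : 'I_3) :
  (forall s, 0 <= s -> (s%:E < T)%E -> \sum_(k < 3) `|p s 0 k| <= K) ->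
  (i < j)%N -> 0 <= t -> (t%:E < T)%E ->
  (q 0 0 i - q 0 0 j) * expR (- (K * t)) <= q t 0 i - q t 0 j.
Proof.
move=> pK ij t0 tT; have [T0 qO _ _] := flow.
pose dq s k := \sum_(l < 3) p s 0 l * expR (- `|q s 0 k - q s 0 l|).
have sT s : 0 < s <= t -> 0 < s /\ (s%:E < T)%E.
  by move=> /andP[-> st]; rewrite (le_lt_trans _ tT)// lee_fin.
apply: (@gronwall_lower_bound R (fun s => q s 0 i - q s 0 j)
  (fun s => dq s i - dq s j)) => //.
- have [qi _] := flow_cvg0 flow i; have [qj _] := flow_cvg0 flow j.
  exact: cvgB.
- move=> s /sT[s0 sltT].
  exact: is_deriveB (flow_q flow s i s0 sltT) (flow_q flow s j s0 sltT).
- move=> s /sT[s0 sltT].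
  have gap : 0 < q s 0 i - q s 0 j.
    by rewrite subr_gt0; apply: Omega_lt => //; apply: qO => //; exact: ltW.
  suff : `|dq s i - dq s j| <= K * (q s 0 i - q s 0 j).
    by rewrite ler_norml => /andP[].
  apply: le_trans (ler_wpM2r (ltW gap) (pK s (ltW s0) sltT)).
  rewrite -sumrB mulr_suml; apply: le_trans (ler_norm_sum _ _ _) _.
  apply: ler_sum => l _; rewrite -mulrBr normrM ler_wpM2l//.
  apply: le_trans (expRN_lipschitz _ _ _ (normr_ge0 _) (normr_ge0 _)) _.
  apply: le_trans (ler_dist_dist _ _) _.
  by rewrite opprB addrA subrK gtr0_norm.
Qed.

Theorem theorem4p1 (R : realType) (T : \bar R) (q p : R -> 'rV[R]_3)
    (u : R -> R -> R)
    (u_sol : threepeakon_solution T q p u)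
    (q0_Omega : Omega (q 0))
    (p0_neq0 : forall i : 'I_3, p 0 0 i != 0)
    (u_collides : exists tstar : R, collides_at T q tstar) :
  (p 0 0 0 < 0 /\ 0 < p 0 0 1) \/ (p 0 0 1 < 0 /\ 0 < p 0 0 2).
Proof.
have [[flow _] _] := u_sol.
have [ts [ts0 tsT [qs q_qs [i [j [ij qsij]]]]]] := u_collides.
apply: contrapT => /not_orP[/not_andP n01 /not_andP n12].
(* The negated conclusion forbids an antipeakon directly to the right of a
   peakon, so all antipeakons lie to the left of all peakons. *)
have sg_mono (a b : 'I_3) : (a < b)%N -> Num.sg (p 0 0 b) <= Num.sg (p 0 0 a).
  have step (x y : R) :
      x != 0 -> y != 0 -> ~ x < 0 \/ ~ 0 < y -> Num.sg y <= Num.sg x.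
    case: (sgrP x) => // _ _; case: (sgrP y) => // _ _ [] // _; lra.
  have s01 := step _ _ (p0_neq0 0) (p0_neq0 1) n01.
  have s12 := step _ _ (p0_neq0 1) (p0_neq0 2) n12.
  by case: (ord3_cases a) => ->; case: (ord3_cases b) => -> // _;
    exact: le_trans s01.
pose K := \sum_(k < 3) `|p 0 0 k|.
have pK s : 0 <= s -> (s%:E < T)%E -> \sum_(k < 3) `|p s 0 k| <= K.
  exact: (flow_mass_le flow s p0_neq0 sg_mono).
wlog lt_ij : i j ij qsij / (i < j)%N => [hw|].
  have := ij; rewrite neq_ltn => /orP[|]; first exact: hw.
  by apply: hw; rewrite 1?eq_sym.
have K0 : 0 <= K by apply: sumr_ge0 => k _; exact: normr_ge0.
pose d := (q 0 0 i - q 0 0 j) * expR (- (K * ts)).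
have d0 : 0 < d by rewrite mulr_gt0 ?expR_gt0// subr_gt0; exact: Omega_lt.
suff : d <= qs 0 i - qs 0 j by rewrite qsij subrr leNgt d0.
have gap_cvg : q s 0 i - q s 0 j @[s --> ts^'-] --> qs 0 i - qs 0 j.
  by apply: cvgB;
    [exact: cvg_comp q_qs (@coord_continuous R 1 3 0 i qs)
    |exact: cvg_comp q_qs (@coord_continuous R 1 3 0 j qs)].
apply: (cvgr_to_ge gap_cvg); near=> s.
have s0 : 0 <= s by near: s; apply: nbhs_left_ge.
have sts : s < ts by near: s; exact: nbhs_left_lt.
have sT : (s%:E < T)%E by rewrite (lt_le_trans _ tsT)// lte_fin.
apply: le_trans (flow_gap_ge flow _ _ _ _ pK lt_ij s0 sT).
by rewrite ler_pM2l ?subr_gt0 ?Omega_lt// ler_expR lerN2 ler_wpM2l// ltW.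
Unshelve. all: by end_near.
Qed.
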